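(* Let $A=\sigma(R)\langle x_1,\dots,x_n\rangle$ be a skew PBW extension of endomorphism type over a ring $R$, with associated family of injective endomorphisms $\Sigma=\{\sigma_1,\dots,\sigma_n\}$ of $R$, and suppose that the elements $c_{i,j}\in R$ ($1\le i,j\le n$) appearing in the relations $x_jx_i-c_{i,j}x_ix_j\in R+Rx_1+\cdots+Rx_n$ are both central and invertible in $R$. If $R$ is a NI and weak $\Sigma$-rigid ring, then $R$ is a weak $\Sigma$-skew Armendariz ring.
   Context: Rings are associative with unity, not necessarily commutative. $\mathbb{N}$ includes $0$. ${\rm nil}(R)$ denotes the set of nilpotent elements of $R$; $R$ is called NI if ${\rm nil}(R)$ is an ideal of $R$. Skew PBW extension: a ring $A$ is a skew PBW extension over a ring $R$, denoted $A=\sigma(R)\langle x_1,\dots,x_n\rangle$, if (i) $R\subseteq A$ (as a subring); (ii) there exist $x_1,\dots,x_n\in A$ such that $A$ is a left free $R$-module with basis ${\rm Mon}(A):=\{x^{\alpha}=x_1^{\alpha_1}\cdots x_n^{\alpha_n}\mid \alpha=(\alpha_1,\dots,\alpha_n)\in\mathbb{N}^n\}$, where $x_1^0\cdots x_n^0:=1$; (iii) for each $1\le i\le n$ and any $r\in R\setminus\{0\}$ there exists $c_{i,r}\in R\setminus\{0\}$ such that $x_ir-c_{i,r}x_i\in R$; (iv) for any $1\le i,j\le n$ there exists $c_{i,j}\in R\setminus\{0\}$ such that $x_jx_i-c_{i,j}x_ix_j\in R+Rx_1+\cdots+Rx_n$. For such $A$, for each $1\le i\le n$ there exist an injective endomorphism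 $\sigma_i:R\to R$ and a $\sigma_i$-derivation $\delta_i:R\to R$ such that $x_ir=\sigma_i(r)x_i+\delta_i(r)$ for every $r\in R$; $\Sigma:=\{\sigma_1,\dots,\sigma_n\}$ denotes the resulting family. $A$ is of endomorphism type if $\delta_i=0$ for every $i$. For $\theta=(\theta_1,\dots,\theta_n)\in\mathbb{N}^n$, $\sigma^{\theta}:=\sigma_1^{\theta_1}\circ\cdots\circ\sigma_n^{\theta_n}$, with $\sigma_j^0={\rm id}_R$. For $X=x^{\alpha}\in{\rm Mon}(A)$, ${\rm exp}(X):=\alpha$. $R$ is weak $\Sigma$-rigid if for each $a\in R$ and every $\theta\in\mathbb{N}^n$: $a\sigma^{\theta}(a)\in{\rm nil}(R)$ if and only if $a\in{\rm nil}(R)$. $R$ is weak $\Sigma$-skew Armendariz (with respect to the skew PBW extension $A$ of endomorphism type) if for all elements $f=\sum_{i=0}^{m}a_iX_i$ and $g=\sum_{j=0}^{t}b_jY_j$ of $A$, with $a_i,b_j\in R$, $X_0=Y_0=1$, the $X_i$ pairwise distinct elements of ${\rm Mon}(A)$ and the $Y_j$ pairwise distinct elements of ${\rm Mon}(A)$, the equality $fg=0$ implies $a_i\sigma^{\alpha_i}(b_j)\in{\rm nil}(R)$ for all $0\le i\le m$ and $0\le j\le t$, where $\alpha_i={\rm exp}(X_i)$. *)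

(* Defs.v *)
From HB Require Import structures.
From mathcomp Require Import all_boot all_order all_algebra.

Set Implicit Arguments.
Unset Strict Implicit.
Unset Printing Implicit Defensive.

Import GRing.Theory.
Local Open Scope ring_scope.

(* The inclusion of R in A as a subring is an injective ring morphism
   iota : R -> A, through which A is a left R-module: r . y = iota r * y.
   Rings may be trivial and need not be commutative (pzRingType). *)

(* The exponent set N^n. *)
Notation exponent n := {ffun 'I_n -> nat}.

Definition nilp (R : pzRingType) (a : R) : Prop := exists k : nat, a ^+ k = 0.

Definition two_sided_ideal (R : pzRingType) (I : R -> Prop) : Prop :=
  [/\ I 0,
      forall a b, I a -> I b -> I (a - b),
      forall r a, I a -> I (r * a)
    & forall r a, I a -> I (a * r)].

Definition NI_ring (R : pzRingType) : Prop := two_sided_ideal (@nilp R).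

Definition central (R : pzRingType) (c : R) : Prop := forall r : R, c * r = r * c.

Definition invertible (R : pzRingType) (c : R) : Prop :=
  exists d : R, d * c = 1 /\ c * d = 1.

Definition left_basis (R A : pzRingType) (iota : {rmorphism R -> A})
    (T : eqType) (e : T -> A) : Prop :=
  (forall f : A, exists s : seq T, exists c : T -> R,
     uniq s /\ f = \sum_(t <- s) iota (c t) * e t)
  /\ (forall (s : seq T) (c : T -> R), uniq s ->
        \sum_(t <- s) iota (c t) * e t = 0 -> forall t, t \in s -> c t = 0).

(* The factors are multiplied in increasing order of the index i. *)
Definition mon (A : pzRingType) (n : nat) (x : 'I_n -> A) (alpha : exponent n) : A :=
  \prod_(i < n) x i ^+ alpha i.

Definition in_base (R A : pzRingType) (iota : {rmorphism R -> A}) (y : A) : Prop :=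
  exists r : R, y = iota r.

(* y \in R + R x_1 + ... + R x_n *)
Definition in_affine (R A : pzRingType) (iota : {rmorphism R -> A})
    (n : nat) (x : 'I_n -> A) (y : A) : Prop :=
  exists (r0 : R) (r : 'I_n -> R), y = iota r0 + \sum_(k < n) iota (r k) * x k.

Definition commutation_coef (R A : pzRingType) (iota : {rmorphism R -> A})
    (n : nat) (x : 'I_n -> A) (i j : 'I_n) (c : R) : Prop :=
  c <> 0 /\ in_affine iota x (x j * x i - iota c * x i * x j).

Record skew_PBW_extension (R A : pzRingType) (iota : {rmorphism R -> A})
    (n : nat) (x : 'I_n -> A) : Prop := SkewPBWExtension {
  pbw_subring : injective iota;
  pbw_basis : left_basis iota (mon x);
  pbw_scalar : forall (i : 'I_n) (r : R), r <> 0 ->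
    exists c : R, c <> 0 /\ in_base iota (x i * iota r - iota c * x i);
  pbw_vars : forall i j : 'I_n, exists c : R, commutation_coef iota x i j c
}.

Definition skew_derivation (R : pzRingType) (s : {rmorphism R -> R}) (d : R -> R) : Prop :=
  (forall a b, d (a + b) = d a + d b)
  /\ (forall a b, d (a * b) = s a * d b + d a * b).

(* By freeness, the families (sigma, delta) satisfying this for a given skew
   PBW extension are unique. *)
Definition associated_maps (R A : pzRingType) (iota : {rmorphism R -> A})
    (n : nat) (x : 'I_n -> A)
    (sigma : 'I_n -> {rmorphism R -> R}) (delta : 'I_n -> R -> R) : Prop :=
  forall i : 'I_n,
    [/\ injective (sigma i),
        skew_derivation (sigma i) (delta i)
      & forall r : R, x i * iota r = iota (sigma i r) * x i + iota (delta i r)].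

Definition endomorphism_type (R : pzRingType) (n : nat) (delta : 'I_n -> R -> R) : Prop :=
  forall (i : 'I_n) (r : R), delta i r = 0.

(* sigma_1^theta_1 \o ... \o sigma_n^theta_n *)
Definition sigma_pow (R : pzRingType) (n : nat) (sigma : 'I_n -> {rmorphism R -> R})
    (theta : exponent n) : R -> R :=
  \big[(fun f g : R -> R => f \o g)/id]_(i < n) iter (theta i) (sigma i).

Definition weak_rigid (R : pzRingType) (n : nat)
    (sigma : 'I_n -> {rmorphism R -> R}) : Prop :=
  forall (a : R) (theta : exponent n),
    nilp (a * sigma_pow sigma theta a) <-> nilp a.

(* X_i = mon x (alpha i), so alpha i = exp(X_i), and similarly Y_j = mon x (beta j). *)
Definition weak_skew_Armendariz (R A : pzRingType) (iota : {rmorphism R -> A})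
    (n : nat) (x : 'I_n -> A) (sigma : 'I_n -> {rmorphism R -> R}) : Prop :=
  forall (m t : nat)
    (a : 'I_m.+1 -> R) (alpha : 'I_m.+1 -> exponent n)
    (b : 'I_t.+1 -> R) (beta : 'I_t.+1 -> exponent n),
    mon x (alpha ord0) = 1 -> injective (fun i => mon x (alpha i)) ->
    mon x (beta ord0) = 1 -> injective (fun j => mon x (beta j)) ->
    (\sum_(i < m.+1) iota (a i) * mon x (alpha i)) *
      (\sum_(j < t.+1) iota (b j) * mon x (beta j)) = 0 ->
    forall (i : 'I_m.+1) (j : 'I_t.+1), nilp (a i * sigma_pow sigma (alpha i) (b j)).

(* Main.v *)
From mathcomp Require Import all_boot all_order all_algebra.
From mathcomp Require Import mpoly.
Require Import Defs.

(** Write N for the set of nilpotent elements of R; it is an ideal, and R/N is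
    reduced.  Weak rigidity, together with the injectivity of the sigma_i, says
    that twisting by a composite sigma^theta does not change products modulo N:
    a sigma^theta(b) lies in N if and only if a b does ([nilp_sigma_pow]).

    In A, reordering the letters of a word in the x_i changes it by an
    invertible left coefficient and by terms of smaller total degree
    ([word_perm]).  Hence x^alpha x^beta = d x^(alpha+beta) + lower terms with d
    invertible ([mon_mul]).

    Let fg = 0.  It suffices to prove that a_i b_j lies in N for all i and j.
    This is done by downward induction on the pairs (alpha_i + beta_j, alpha_i),
    ordered lexicographically, where exponents are compared first by total
    degree and then lexicographically ([nilp_coef_mul]).  For a given (i, j),
    take the coefficient of x^gamma in fg, with gamma = alpha_i + beta_j, and
    multiply it on the right by a_i.  Consider the contribution of another pair
    (k, l):
    - if (k, l) is larger than (i, j), then a_k b_l lies in N by induction, and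
      so does the contribution;
    - otherwise alpha_k + beta_l has total degree at most that of gamma, so the
      contribution vanishes unless alpha_k + beta_l = gamma;
    - in that last case alpha_k < alpha_i, so alpha_i + beta_l > gamma, hence
      a_i b_l lies in N by induction; R/N being reduced, the contribution,
      which has the form a_k sigma^(alpha_k)(b_l) z a_i, lies in N.
    What remains is a_i sigma^(alpha_i)(b_j) d a_i in N with d invertible,
    whence a_i b_j lies in N. *)

Set Implicit Arguments.
Unset Strict Implicit.
Unset Printing Implicit Defensive.

Import Order.TTheory GRing.Theory.
Local Open Scope ring_scope.

(** * Nilpotent elements of an NI ring *)

Lemma nilp_sqr (R : pzRingType) (a : R) : nilp (a * a) -> nilp a.
Proof. by case=> k hk; exists (2 * k)%N; rewrite exprM expr2. Qed.

Lemma nilp_mulC (R : pzRingType) (a b : R) : nilp (a * b) -> nilp (b * a).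
Proof.
case=> k hk; exists k.+1.
suff -> : (b * a) ^+ k.+1 = b * (a * b) ^+ k * a by rewrite hk mulr0 mul0r.
elim: k {hk} => [|k IHk]; first by rewrite expr1 expr0 mulr1.
by rewrite exprS IHk [in RHS]exprS !mulrA.
Qed.

Lemma nilp_rmorph (R S : pzRingType) (s : {rmorphism R -> S}) (a : R) :
  nilp a -> nilp (s a).
Proof. by case=> k hk; exists k; rewrite -rmorphXn hk rmorph0. Qed.

Lemma nilp_rmorph_inj (R S : pzRingType) (s : {rmorphism R -> S}) (a : R) :
  injective s -> nilp (s a) -> nilp a.
Proof.
by move=> s_inj [k hk]; exists k; apply: s_inj; rewrite rmorphXn hk rmorph0.
Qed.

Section NI.

Variables (R : pzRingType) (hNI : NI_ring R).

Lemma nilp_mulMr (a r : R) : nilp a -> nilp (a * r).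
Proof. by case: hNI => _ _ _; apply. Qed.

Lemma nilp_mulMl (r a : R) : nilp a -> nilp (r * a).
Proof. by case: hNI => _ _ + _; apply. Qed.

Lemma nilpN (a : R) : nilp a -> nilp (- a).
Proof. by rewrite -mulN1r; apply: nilp_mulMl. Qed.

Lemma nilpD (a b : R) : nilp a -> nilp b -> nilp (a + b).
Proof.
case: hNI => _ nilB _ _ ha hb; rewrite -[b]opprK.
by apply: nilB => //; apply: nilpN.
Qed.

(** Zero products in the reduced ring R/nil(R) absorb arbitrary middle factors. *)
Lemma nilp_insert (a r b : R) : nilp (a * b) -> nilp (a * r * b).
Proof.
move=> /nilp_mulC hba; apply: nilp_sqr.
rewrite (_ : _ * _ = a * r * (b * a) * (r * b)); last by rewrite !mulrA.
exact/nilp_mulMr/nilp_mulMl.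
Qed.

Lemma nilp_cancel_unit (a b c : R) :
  invertible c -> nilp (a * b * c * a) -> nilp (a * b).
Proof.
move=> [d [dc1 _]]; rewrite -mulrA => /nilp_mulC h.
have {}h : nilp (a * (a * b)).
  rewrite (_ : _ * _ = d * (c * a * (a * b))); first exact: nilp_mulMl.
  by rewrite !mulrA dc1 mul1r.
apply: nilp_sqr; by move/(nilp_insert b): h; rewrite !mulrA.
Qed.

End NI.

(** * Twists by a composite endomorphism *)

Section Rigid.

Variables (R : pzRingType) (s : {rmorphism R -> R}).
Hypothesis hNI : NI_ring R.
Hypothesis s_inj : injective s.
Hypothesis s_rigid : forall a, nilp (a * s a) -> nilp a.

(** With u = a s(b), the product u s(u) contains the factor s(b) s(a) = s(b a). *)
Lemma nilp_twist (a b : R) : nilp (a * b) -> nilp (a * s b).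
Proof.
move=> /nilp_mulC hba; apply: s_rigid.
have h : nilp (s b * s a) by rewrite -rmorphM; apply: nilp_rmorph.
rewrite rmorphM -mulrA; apply: (nilp_mulMl hNI); rewrite mulrA.
exact: (nilp_mulMr hNI).
Qed.

(** Twisting the second factor of s(b) a gives s(b) s(a) = s(b a). *)
Lemma nilp_untwist (a b : R) : nilp (a * s b) -> nilp (a * b).
Proof.
move=> /nilp_mulC /nilp_twist h; apply/nilp_mulC/(nilp_rmorph_inj s_inj).
by rewrite rmorphM.
Qed.

End Rigid.

Lemma sigma_pow_rmorph (R : pzRingType) (n : nat)
    (sigma : 'I_n -> {rmorphism R -> R}) (theta : exponent n) :
  (forall i, injective (sigma i)) ->
  exists s : {rmorphism R -> R},
    injective s /\ sigma_pow sigma theta = s :> (R -> R).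
Proof.
move=> sigma_inj; rewrite /sigma_pow.
pose K (f : R -> R) := exists s : {rmorphism R -> R}, injective s /\ f = s.
apply: (big_ind K).
- by exists idfun; split => // a b.
- move=> _ _ [s [s_inj ->]] [t [t_inj ->]].
  by exists (s \o t); split => //; apply: inj_comp.
- move=> i _; elim: (theta i) => [|k [s [s_inj es]]].
    by exists idfun; split => // a b.
  exists (sigma i \o s); split; first exact: inj_comp.
  by rewrite [RHS]/= -es.
Qed.

(** * Left linear combinations of a family *)

Section Span.

Variables (R A : pzRingType) (iota : {rmorphism R -> A}).

(** The left linear combination of the family [e] given by a list of pairs
    (coefficient, index); an index may occur several times. *)
Definition lcomb (T : Type) (e : T -> A) (L : seq (R * T)) : A :=
  \sum_(p <- L) iota p.1 * e p.2.

(** [f] is a left linear combination of the [e t] for the indices [t] in [P]. *)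
Definition in_span (T : Type) (e : T -> A) (P : pred T) (f : A) : Prop :=
  exists2 L : seq (R * T), all (fun p => P p.2) L & f = lcomb e L.

Section OneFamily.

Variables (T : Type) (e : T -> A) (P : pred T).

Lemma in_span0 : in_span e P 0.
Proof. by exists [::]; rewrite // /lcomb big_nil. Qed.

Lemma in_spanD f g : in_span e P f -> in_span e P g -> in_span e P (f + g).
Proof.
move=> [L PL ->] [M PM ->]; exists (L ++ M); first by rewrite all_cat PL.
by rewrite /lcomb big_cat.
Qed.

Lemma in_spanZ r f : in_span e P f -> in_span e P (iota r * f).
Proof.
move=> [L PL ->]; exists [seq (r * p.1, p.2) | p <- L]; first by rewrite all_map.
rewrite /lcomb big_map mulr_sumr; apply: eq_bigr => p _ /=.
by rewrite rmorphM mulrA.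
Qed.

Lemma in_span_gen t : P t -> in_span e P (e t).
Proof.
by move=> Pt; exists [:: (1, t)]; rewrite /= ?Pt // /lcomb big_seq1 rmorph1 mul1r.
Qed.

Lemma in_span_sum (I : Type) (s : seq I) (F : I -> A) :
  (forall i, in_span e P (F i)) -> in_span e P (\sum_(i <- s) F i).
Proof.
move=> hF; elim/big_rec: _ => [|i f _]; [exact: in_span0 | exact: in_spanD].
Qed.

End OneFamily.

(** An additive map [h] that is semilinear with respect to a map [tau] of the
    scalars carries a span into another one as soon as it does so on the
    generators. *)
Lemma in_span_semilinear (T U : Type) (e : T -> A) (P : pred T)
    (e' : U -> A) (Q : pred U) (h : A -> A) (tau : R -> R) :
  h 0 = 0 -> {morph h : f g / f + g} ->
  (forall r f, h (iota r * f) = iota (tau r) * h f) ->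
  (forall t, P t -> in_span e' Q (h (e t))) ->
  forall f, in_span e P f -> in_span e' Q (h f).
Proof.
move=> h0 hD hZ hgen _ [L PL ->]; elim: L PL => [|[r t] L IHL] /=.
  by move=> _; rewrite /lcomb big_nil h0; apply: in_span0.
case/andP=> Pt /IHL; rewrite /lcomb big_cons hD /= => IH.
by apply: in_spanD => //; rewrite hZ; apply/in_spanZ/hgen.
Qed.

Lemma in_span_trans (T U : Type) (e : T -> A) (P : pred T)
    (e' : U -> A) (Q : pred U) f :
  (forall t, P t -> in_span e' Q (e t)) -> in_span e P f -> in_span e' Q f.
Proof. by move=> h; apply: (@in_span_semilinear _ _ e P e' Q id id). Qed.

Lemma in_spanS (T : Type) (e : T -> A) (P Q : pred T) f :
  subpred P Q -> in_span e P f -> in_span e Q f.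
Proof. by move=> PQ; apply: in_span_trans => t /PQ; apply: in_span_gen. Qed.

End Span.

(** * Reordering words in the variables *)

Lemma invertible1 (R : pzRingType) : invertible (1 : R).
Proof. by exists 1; rewrite mulr1. Qed.

Lemma invertibleM (R : pzRingType) (c d : R) :
  invertible c -> invertible d -> invertible (c * d).
Proof.
move=> [c' [c'c cc']] [d' [d'd dd']]; exists (d' * c'); split.
  by rewrite mulrA -(mulrA d') c'c mulr1.
by rewrite mulrA -(mulrA c) dd' mulr1.
Qed.

Lemma invertible_rmorph (R S : pzRingType) (s : {rmorphism R -> S}) (c : R) :
  invertible c -> invertible (s c).
Proof. by move=> [d [dc cd]]; exists (s d); rewrite -!rmorphM dc cd rmorph1. Qed.

Section Words.

Variables (R A : pzRingType) (iota : {rmorphism R -> A}).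
Variables (n : nat) (x : 'I_n -> A).
Variables (sigma : 'I_n -> {rmorphism R -> R}) (c : 'I_n -> 'I_n -> R).
Hypothesis x_scalar : forall i r, x i * iota r = iota (sigma i r) * x i.
Hypothesis x_comm : forall i j,
  in_affine iota x (x j * x i - iota (c i j) * x i * x j).
Hypothesis c_inv : forall i j, invertible (c i j).

(** The product of the variables listed in [w]. *)
Definition word (w : seq 'I_n) : A := \prod_(i <- w) x i.

(** The span of the words of length less than [k]. *)
Definition shorter (k : nat) : A -> Prop :=
  in_span iota word (fun w => (size w < k)%N).

Lemma word_cat u v : word (u ++ v) = word u * word v.
Proof. exact: big_cat. Qed.

Lemma word_cons i v : word (i :: v) = x i * word v.
Proof. exact: big_cons. Qed.

Lemma shorter_mulx i k f : shorter k f -> shorter k.+1 (x i * f).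
Proof.
apply: (in_span_semilinear (tau := sigma i)).
- exact: mulr0.
- by move=> g h; rewrite mulrDr.
- by move=> r g; rewrite mulrA x_scalar mulrA.
- by move=> w hw; rewrite -word_cons; apply: in_span_gen.
Qed.

Lemma shorter_mulw v k f : shorter k f -> shorter (k + size v) (f * word v).
Proof.
apply: (in_span_semilinear (h := fun f => f * word v) (tau := id)).
- exact: mul0r.
- by move=> g h; rewrite mulrDl.
- by move=> r g; rewrite mulrA.
- move=> w hw; rewrite -word_cat; apply: in_span_gen.
  by rewrite size_cat ltn_add2r.
Qed.

Lemma shorter_affine f : in_affine iota x f -> shorter 2 f.
Proof.
move=> [r0 [r ->]]; apply: in_spanD.
  rewrite -[iota r0]mulr1 -[1](big_nil _ _ xpredT x : word [::] = 1).
  exact/in_spanZ/in_span_gen.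
apply: in_span_sum => k; apply: in_spanZ.
by rewrite -[x k](big_seq1 _ _ x : word [:: k] = x k); apply: in_span_gen.
Qed.

(** Moving one letter to the right through a word, by the relations between two
    variables. *)
Lemma word_move i u v : exists2 d, invertible d &
  shorter (size (u ++ i :: v)) (word (i :: u ++ v) - iota d * word (u ++ i :: v)).
Proof.
elim: u => [|j u [d d_inv IHu]].
  exists 1; first exact: invertible1.
  by rewrite rmorph1 mul1r subrr; apply: in_span0.
exists (c j i * sigma j d); first exact/invertibleM/invertible_rmorph.
(* Exchange the letters i and j, then apply sigma_j to d when pulling it out to
   the left of x_j. *)
have -> : word (i :: (j :: u) ++ v)
    - iota (c j i * sigma j d) * word ((j :: u) ++ i :: v)
  = (x i * x j - iota (c j i) * x j * x i) * word (u ++ v)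
    + iota (c j i)
      * (x j * (word (i :: u ++ v) - iota d * word (u ++ i :: v))).
  rewrite /= !word_cons rmorphM mulrBl mulrBr mulrBr (mulrA (x j) (iota d)) x_scalar.
  by rewrite !mulrA addrA subrK.
apply: in_spanD; last exact/in_spanZ/shorter_mulx.
move: (shorter_mulw (u ++ v) (shorter_affine (x_comm j i))).
by rewrite /= !size_cat /= addnS addSn.
Qed.

Lemma word_perm w w' : perm_eq w w' -> exists2 d, invertible d &
  shorter (size w) (word w - iota d * word w').
Proof.
elim: w w' => [|i w IHw] w' pw.
  exists 1; first exact: invertible1.
  move: pw; rewrite perm_sym => /perm_nilP ->.
  by rewrite rmorph1 mul1r subrr; apply: in_span0.
have /splitPr ew : i \in w' by rewrite -(perm_mem pw) mem_head.
case: ew pw => u v pw.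
have {pw} puv : perm_eq w (u ++ v).
  by move: pw; rewrite perm_sym perm_catC /= perm_cons perm_catC perm_sym.
have [d d_inv hd] := IHw _ puv; have [d' d'_inv hd'] := word_move i u v.
exists (sigma i d * d'); first exact/invertibleM/d'_inv/invertible_rmorph.
have -> : word (i :: w) - iota (sigma i d * d') * word (u ++ i :: v)
  = x i * (word w - iota d * word (u ++ v))
    + iota (sigma i d) * (word (i :: u ++ v) - iota d' * word (u ++ i :: v)).
  rewrite !word_cons !mulrBr rmorphM (mulrA (x i) (iota d)) x_scalar !mulrA.
  by rewrite addrA subrK.
apply: in_spanD; first exact: shorter_mulx.
by apply: in_spanZ; move: hd'; rewrite !size_cat /= addnS -size_cat -(perm_size puv).
Qed.

(** * Products of standard monomials *)

(** The same exponent as a multinomial; these are totally ordered by total degree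
    first, then lexicographically, and this order is compatible with addition. *)
Definition mnm_of (alpha : exponent n) : 'X_{1..n} := [multinom alpha i | i < n].

(** The sum of two exponents. *)
Definition addexp (alpha beta : exponent n) : exponent n :=
  [ffun i => alpha i + beta i]%N.

Lemma mnm_of_inj : injective mnm_of.
Proof. by move=> a b /mnmP eab; apply/ffunP => i; move: (eab i); rewrite !mnmE. Qed.

Lemma mnm_of_add alpha beta :
  mnm_of (addexp alpha beta) = (mnm_of alpha + mnm_of beta)%MM.
Proof. by apply/mnmP => i; rewrite mnmDE !mnmE ffunE. Qed.

(** The word x_1 ... x_1 x_2 ... x_n ... x_n of a standard monomial. *)
Definition std_word (alpha : exponent n) : seq 'I_n :=
  flatten [seq nseq (alpha i) i | i <- index_enum _].

Lemma mon_std_word alpha : mon x alpha = word (std_word alpha).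
Proof.
rewrite /mon /word /std_word big_flatten big_map.
by apply: eq_bigr => i _; rewrite big_nseq; elim: (alpha i) => //= k <-; rewrite exprS.
Qed.

Lemma count_std_word alpha i : count_mem i (std_word alpha) = alpha i.
Proof.
rewrite /std_word count_flatten -map_comp sumnE big_map.
rewrite (bigD1 i) //= count_nseq /= eqxx mul1n big1 ?addn0 // => j /negPf ji.
by rewrite /= count_nseq /= ji.
Qed.

Lemma size_std_word alpha : size (std_word alpha) = mdeg (mnm_of alpha).
Proof.
rewrite /std_word size_flatten /shape -map_comp sumnE big_map.
by rewrite mdegE; apply: eq_bigr => i _; rewrite /= size_nseq mnmE.
Qed.

Lemma perm_std_word w (alpha : exponent n) :
  (forall i, count_mem i w = alpha i) -> perm_eq w (std_word alpha).
Proof. by move=> hw; apply/allP => i _; rewrite /= hw count_std_word. Qed.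

(** The span of the standard monomials of total degree less than [k]. *)
Definition lower (k : nat) : A -> Prop :=
  in_span iota (mon x) (fun alpha => (mdeg (mnm_of alpha) < k)%N).

(** A word is, up to a coefficient, the standard monomial with the same letters,
    modulo strictly shorter words. *)
Lemma shorter_lower k f : shorter k f -> lower k f.
Proof.
elim: k f => [|k IHk] f; apply: in_span_trans => // w.
rewrite ltnS => hw.
pose alpha : exponent n := [ffun i => count_mem i w].
have pw : perm_eq w (std_word alpha).
  by apply: perm_std_word => i; rewrite ffunE.
have [d _ hd] := word_perm pw.
rewrite -(subrK (iota d * word (std_word alpha)) (word w)).
apply: in_spanD; last first.
  rewrite -mon_std_word; apply/in_spanZ/in_span_gen.
  by rewrite -size_std_word -(perm_size pw).
have /IHk : shorter k (word w - iota d * word (std_word alpha)).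
  by apply: in_spanS hd => v hv; apply: leq_trans hw.
by apply: in_spanS => beta /ltnW.
Qed.

(** The leading term of a product of two standard monomials, together with the
    invertibility of its coefficient. *)
Lemma mon_mul alpha beta : exists2 d, invertible d &
  lower (mdeg (mnm_of (addexp alpha beta)))
    (mon x alpha * mon x beta - iota d * mon x (addexp alpha beta)).
Proof.
have pw : perm_eq (std_word alpha ++ std_word beta) (std_word (addexp alpha beta)).
  by apply: perm_std_word => i; rewrite count_cat !count_std_word ffunE.
have [d d_inv hd] := word_perm pw; exists d => //; apply: shorter_lower.
by rewrite -size_std_word -(perm_size pw) !mon_std_word -word_cat.
Qed.

Lemma mon_scalar alpha r :
  mon x alpha * iota r = iota (sigma_pow sigma alpha r) * mon x alpha.
Proof.
rewrite /mon /sigma_pow.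
pose K (y : A) (f : R -> R) := forall r, y * iota r = iota (f r) * y.
move: r; apply: (big_rec2 K); first by move=> r; rewrite mul1r mulr1.
move=> i y f _ hK r; rewrite -mulrA hK !mulrA /=; congr (_ * _).
elim: (alpha i) (f r) => {hK} [|k IHk] r' /=; first by rewrite expr0 mul1r mulr1.
by rewrite exprS -mulrA IHk mulrA x_scalar mulrA.
Qed.

End Words.

(** * Coefficients with respect to a left basis *)

(** In a vanishing combination of basis elements, the total coefficient of each
    basis element vanishes. *)
Lemma lcomb_coef (R A : pzRingType) (iota : {rmorphism R -> A})
    (T : eqType) (e : T -> A) (L : seq (R * T)) (t : T) :
  left_basis iota e -> lcomb iota e L = 0 -> \sum_(p <- L | p.2 == t) p.1 = 0.
Proof.
move=> [_ indep] hL; pose s := undup (map snd L).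
pose coef u := \sum_(p <- L | p.2 == u) p.1.
have hs : \sum_(u <- s) iota (coef u) * e u = 0.
  rewrite -[RHS]hL /lcomb (eq_bigr (fun u => \sum_(p <- L | p.2 == u) iota p.1 * e p.2)).
    rewrite (exchange_big_dep xpredT) //= big_seq [RHS]big_seq.
    apply: eq_bigr => p pL; rewrite big_mkcond (bigD1_seq p.2) ?undup_uniq //=.
      by rewrite eqxx /= big1 ?addr0 // => u /negPf; rewrite eq_sym => ->.
    by rewrite mem_undup map_f.
  move=> u _; rewrite /coef rmorph_sum mulr_suml.
  by apply: eq_bigr => p /eqP ->.
have [ts|nts] := boolP (t \in s); first exact: (indep _ _ (undup_uniq _) hs).
rewrite big_seq_cond big_pred0 // => p; apply: contraNF nts => /andP[pL /eqP <-].
by rewrite mem_undup map_f.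
Qed.

(** * The weak Armendariz property *)

(** Downward induction along a map from a finite type to an ordered one. *)
Lemma fin_downward_ind (T : finType) (disp : Order.disp_t) (O : porderType disp)
    (key : T -> O) (P : T -> Prop) :
  (forall t, (forall u, (key t < key u)%O -> P u) -> P t) -> forall t, P t.
Proof.
move=> hP t; have [k] := ubnP #|[set u | (key t < key u)%O]|.
elim: k t => // k IHk t; rewrite ltnS => hk; apply: hP => u tu; apply: IHk.
apply: leq_trans hk; apply: proper_card; apply/properP; split.
  by apply/subsetP => v; rewrite !inE; apply: lt_trans.
by exists u; rewrite inE // ltxx.
Qed.

Section Armendariz.

Variables (R A : pzRingType) (iota : {rmorphism R -> A}).
Variables (n : nat) (x : 'I_n -> A).
Variables (sigma : 'I_n -> {rmorphism R -> R}) (c : 'I_n -> 'I_n -> R).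
Hypothesis x_basis : left_basis iota (mon x).
Hypothesis sigma_inj : forall i, injective (sigma i).
Hypothesis x_scalar : forall i r, x i * iota r = iota (sigma i r) * x i.
Hypothesis x_comm : forall i j,
  in_affine iota x (x j * x i - iota (c i j) * x i * x j).
Hypothesis c_inv : forall i j, invertible (c i j).
Hypothesis hNI : NI_ring R.
Hypothesis hrigid : weak_rigid sigma.

Lemma nilp_sigma_pow (theta : exponent n) (a b : R) :
  nilp (a * sigma_pow sigma theta b) <-> nilp (a * b).
Proof.
have [s [s_inj es]] := sigma_pow_rmorph theta sigma_inj.
have s_rigid r : nilp (r * s r) -> nilp r.
  by rewrite -es => /(proj1 (hrigid r theta)).
by rewrite es; split; [apply: nilp_untwist | apply: nilp_twist].
Qed.

Variables (m t : nat) (a : 'I_m -> R) (alpha : 'I_m -> exponent n).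
Variables (b : 'I_t -> R) (beta : 'I_t -> exponent n).
Hypotheses (alpha_inj : injective alpha) (beta_inj : injective beta).
Hypothesis fg0 : (\sum_(i < m) iota (a i) * mon x (alpha i)) *
                 (\sum_(j < t) iota (b j) * mon x (beta j)) = 0.

(** The exponent of the leading monomial of the product of two terms. *)
Let gamma (p : 'I_m * 'I_t) : exponent n := addexp (alpha p.1) (beta p.2).

(** The coefficient obtained by moving [b p.2] to the left of x^(alpha p.1). *)
Let e (p : 'I_m * 'I_t) : R := a p.1 * sigma_pow sigma (alpha p.1) (b p.2).

(** The list [L p] expands the product of the two monomials of the pair [p], so
    the sum over [L p] is the coefficient of x^g in that product.  It vanishes
    for [g] of total degree at least that of [gamma p], except for
    [g = gamma p], where it is invertible.  The last clause says that the
    coefficient of x^g in the product of the two elements is zero. *)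
Lemma product_coef : exists L : 'I_m * 'I_t -> seq (R * exponent n),
  forall g : exponent n,
  [/\ forall p, (mdeg (mnm_of (gamma p)) <= mdeg (mnm_of g))%N -> gamma p != g ->
        \sum_(q <- L p | q.2 == g) q.1 = 0,
      forall p, gamma p = g -> invertible (\sum_(q <- L p | q.2 == g) q.1)
    & \sum_p e p * \sum_(q <- L p | q.2 == g) q.1 = 0].
Proof.
have /fin_all_exists[u hu] (p : 'I_m * 'I_t) : exists u : R * seq (R * exponent n),
    [/\ invertible u.1,
        all (fun q => mdeg (mnm_of q.2) < mdeg (mnm_of (gamma p)))%N u.2
      & mon x (alpha p.1) * mon x (beta p.2)
          = lcomb iota (mon x) ((u.1, gamma p) :: u.2)].
  have [d d_inv [L degL /eqP]] :=
    mon_mul x_scalar x_comm c_inv (alpha p.1) (beta p.2).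
  rewrite subr_eq addrC => /eqP eL; exists (d, L); split=> //.
  by rewrite eL [RHS]big_cons.
have low g p : (mdeg (mnm_of (gamma p)) <= mdeg (mnm_of g))%N ->
    \sum_(q <- (u p).2 | q.2 == g) q.1 = 0.
  move=> hg; have [_ /allP hL _] := hu p.
  rewrite big_seq_cond big_pred0 // => q; apply/negP => /andP[/hL + /eqP eq].
  by rewrite eq ltnNge hg.
exists (fun p => ((u p).1, gamma p) :: (u p).2) => g; split.
- by move=> p hg /negPf ng; rewrite big_cons /= ng low.
- by move=> p eg; rewrite big_cons /= eg eqxx low ?addr0 -?eg //; case: (hu p).
pose L := flatten [seq [seq (e p * q.1, q.2) | q <- ((u p).1, gamma p) :: (u p).2]
                  | p : 'I_m * 'I_t].
have hL : lcomb iota (mon x) L = 0.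
  rewrite -fg0 big_distrlr pair_bigA /L /lcomb big_flatten big_image.
  apply: eq_bigr => p _; have [_ _ ep] := hu p.
  rewrite big_map /= mulrA -(mulrA (iota (a p.1))) (mon_scalar x_scalar) mulrA -rmorphM -mulrA.
  rewrite ep -/(e p) /lcomb mulr_sumr.
  by apply: eq_bigr => q _; rewrite rmorphM mulrA.
rewrite -[RHS](lcomb_coef g x_basis hL) /L big_flatten big_image.
by apply: eq_bigr => p _; rewrite big_map mulr_sumr.
Qed.

Lemma nilp_coef_mul (p : 'I_m * 'I_t) : nilp (a p.1 * b p.2).
Proof.
pose key (p : 'I_m * 'I_t) : 'X_{1..n} *l 'X_{1..n} :=
  (mnm_of (gamma p), mnm_of (alpha p.1)).
have key_lt q r : (mnm_of (gamma q) < mnm_of (gamma r))%O -> (key q < key r)%O.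
  by move=> h; rewrite Order.ProdLexiOrder.ltEprodlexi /= ltW //= leNgt h.
have [L hL] := product_coef.
elim/(fin_downward_ind (key := key)): p => p IH.
have [hL0 hL1 hLS] := hL (gamma p).
apply/(nilp_sigma_pow (alpha p.1)); rewrite -/(e p).
apply: (nilp_cancel_unit hNI (hL1 p erefl)); rewrite -/(e p).
(* The contribution of p times a p.1 is minus the sum of the other ones times
   a p.1. *)
move: hLS; rewrite (bigD1 p) //= => /eqP; rewrite addr_eq0 => /eqP ->.
rewrite mulNr mulr_suml -sumrN.
elim/big_rec: _ => [|q f qp hf]; first by case: hNI.
apply: nilpD => //; apply: nilpN => //.
(* The contribution of another pair q, multiplied on the right by a p.1. *)
have [hq|/negbTE nq] := boolP (key p < key q)%O.
  by do 2 apply: nilp_mulMr => //; apply/nilp_sigma_pow/IH.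
have dq : (mdeg (mnm_of (gamma q)) <= mdeg (mnm_of (gamma p)))%N.
  by rewrite leqNgt; apply: contraFN nq => /lt_mdeg_ltmc /key_lt.
have [eg|/hL0 -> //] := eqVneq (gamma q) (gamma p); last first.
  by rewrite mulr0 mul0r; exists 1%N.
apply: nilp_insert => //.
have aq : (mnm_of (alpha q.1) < mnm_of (alpha p.1))%O.
  rewrite lt_neqAle; apply/andP; split.
    (* Equal first exponents and equal sums give equal second exponents. *)
    apply: contraNN qp => /eqP/mnm_of_inj/alpha_inj e1.
    rewrite [q]surjective_pairing [p]surjective_pairing -e1.
    have -> // : q.2 = p.2.
    apply/beta_inj/ffunP => i; move/ffunP/(_ i): eg.
    by rewrite !ffunE e1 => /addnI.
  rewrite leNgt; apply: contraFN nq => h.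
  by rewrite Order.ProdLexiOrder.ltEprodlexi /= eg lexx.
(* The pair (p.1, q.2) has exponent sum greater than gamma q = gamma p. *)
rewrite /e -mulrA; apply: nilp_mulMl => //; apply: nilp_mulC.
apply/nilp_sigma_pow/(IH (p.1, q.2))/key_lt.
by rewrite -eg /= !mnm_of_add ltmc_add2l.
Qed.

End Armendariz.

Theorem theorem4p4 (R A : pzRingType) (iota : {rmorphism R -> A})
    (n : nat) (x : 'I_n -> A)
    (sigma : 'I_n -> {rmorphism R -> R}) (delta : 'I_n -> R -> R)
    (c : 'I_n -> 'I_n -> R)
    (hA : skew_PBW_extension iota x)
    (hmaps : associated_maps iota x sigma delta)
    (hendo : endomorphism_type delta)
    (hc : forall i j : 'I_n, commutation_coef iota x i j (c i j))
    (hcentral : forall i j : 'I_n, central (c i j))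
    (hinv : forall i j : 'I_n, invertible (c i j))
    (hNI : NI_ring R)
    (hrigid : weak_rigid sigma) :
  weak_skew_Armendariz iota x sigma.
Proof.
have sigma_inj i : injective (sigma i) by case: (hmaps i).
have x_scalar i r : x i * iota r = iota (sigma i r) * x i.
  by case: (hmaps i) => _ _ ->; rewrite hendo rmorph0 addr0.
have x_comm i j : in_affine iota x (x j * x i - iota (c i j) * x i * x j).
  by case: (hc i j).
move=> m t a alpha b beta _ alpha_inj _ beta_inj fg0 i j.
apply/(nilp_sigma_pow sigma_inj hNI hrigid).
apply: (nilp_coef_mul (pbw_basis hA) sigma_inj x_scalar x_comm hinv hNI hrigid
          _ _ fg0 (i, j)).
  by move=> k l e; apply: alpha_inj; rewrite e.
by move=> k l e; apply: beta_inj; rewrite e.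
Qed.
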